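(* Let $z\in\mathbb{R}^n$ and consider the problem of minimizing $J(x)=\frac12\|x-z\|^2$ over $\mathcal{A}=\{x\in\mathbb{R}^n \mid f_i(x)\le 0 \text{ for all } i\in I\}$, $I=\{1,\dots,m\}$, where each $f_i\colon\mathbb{R}^n\to(-\infty,+\infty]$ is proper, lower semicontinuous and $\rho_i$-weakly convex with $\rho_i\ge 0$. Let $J^*=\inf_{x\in\mathcal{A}}J(x)$. Suppose that $\mathcal{A}\neq\varnothing$ and that there exists $\alpha>J^*$ such that all functions $f_i$, $i\in I$, are finite-valued and continuous on an open set containing $E:=\{x\in\mathbb{R}^n\mid J(x)\le\alpha\}$. Let $(x_k)_{k\in\mathbb{N}}$ be a sequence generated by the Cutting spheres algorithm (described in the context). Then: (i) $(x_k)_{k\in\mathbb{N}}$ possesses a convergent subsequence, and every sequential cluster point of $(x_k)_{k\in\mathbb{N}}$ is a global minimizer of $J$ over $\mathcal{A}$; (ii) if $J$ has a unique global minimizer over $\mathcal{A}$, then $(x_k)_{k\in\mathbb{N}}$ converges to it; (iii) $(J(x_k))_{k\in\mathbb{N}}$ is a nondecreasing sequence converging to $J^*$.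
   Context: A function $f\colon\mathbb{R}^n\to(-\infty,+\infty]$ is $\rho$-weakly convex ($\rho\ge0$) if $f+\frac{\rho}{2}\|\cdot\|^2$ is convex. For $\widetilde{x}$ with $f_i(\widetilde{x})<+\infty$, $\partial_{\rm lsc}f_i(\widetilde{x})$ is the set of functions $\varphi\colon\mathbb{R}^n\to\mathbb{R}$ of the form $\varphi(x)=-a\|x\|^2+\langle b,x\rangle$ with $a\ge\rho_i/2$, $b\in\mathbb{R}^n$, such that $f_i(x)-f_i(\widetilde{x})\ge\varphi(x)-\varphi(\widetilde{x})$ for all $x\in\mathbb{R}^n$. For such $\varphi$, set $L_i(\varphi,\widetilde{x})(x)=\varphi(x)+f_i(\widetilde{x})-\varphi(\widetilde{x})$. For $x\in\mathbb{R}^n$, $I(x)=\{i\in I\mid f_i(x)>0\}$. Cutting spheres algorithm: set $x_0=z$, $\mathcal{O}_{-1}=\mathbb{R}^n$. For $k=0,1,2,\dots$: - if $I(x_k)\ne\varnothing$: choose $\varphi_i^k\in\partial_{\rm lsc}f_i(x_k)$ for every $i\in I(x_k)$, set $\mathcal{O}_k=\{x\in\mathbb{R}^n\mid L_i(\varphi_i^k,x_k)(x)\le0 \text{ for all } i\in I(x_k)\}\cap\mathcal{O}_{k-1}$, and choose $x_{k+1}\in\arg\min_{x\in\mathcal{O}_k}\|x-z\|^2$; - otherwise: set $\mathcal{O}_k=\mathcal{O}_{k-1}$ and $x_{k+1}=x_k$. Curvature convention: for each $i\in I$ a constant $a_i\in[\rho_i/2,+\infty)$ is fixed once and for all, and all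 chosen $\varphi_i^k$ have the form $\varphi_i^k(x)=-a_i\|x\|^2+\langle b_i^k,x\rangle$ with $b_i^k\in\mathbb{R}^n$ (the same $a_i$ at every iteration $k$). *)

(* Defs.v *)
From mathcomp Require Import all_boot all_order all_algebra.
From mathcomp Require Import all_classical all_reals all_analysis.

Set Implicit Arguments.
Unset Strict Implicit.
Unset Printing Implicit Defensive.

Import Order.TTheory GRing.Theory Num.Theory.
Import numFieldNormedType.Exports.

Local Open Scope classical_set_scope.
Local Open Scope ring_scope.

Section euclidean.
Context {R : realType} {n : nat}.
Implicit Types x y : 'rV[R]_n.

Definition dot x y : R := \sum_(i < n) x 0 i * y 0 i.

(* The library norm `|x| on row vectors is the max norm; it induces the same
   topology, but the spheres and distances below are Euclidean. *)
Definition enorm x : R := Num.sqrt (dot x x).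

End euclidean.

Section optimization.
Context {R : realType}.

Definition argmin {T : Type} (D : set T) (J : T -> R) : set T :=
  [set x | D x /\ forall y, D y -> J x <= J y].

Definition proper_function {T : Type} (f : T -> \bar R) : Prop :=
  (forall x, f x != -oo%E) /\ exists x, (f x < +oo)%E.

(* Meant for g with values in ]-oo, +oo], so that no sum +oo - oo occurs; since
   0 * +oo = 0 in \bar R, the inequality is an equality for t = 0 and t = 1. *)
Definition econvex {n : nat} (g : 'rV[R]_n -> \bar R) : Prop :=
  forall (x y : 'rV[R]_n) (t : R), 0 <= t <= 1 ->
    (g (t *: x + (1 - t) *: y)%R <= t%:E * g x + (1 - t)%:E * g y)%E.

Definition weakly_convex {n : nat} (rho : R) (f : 'rV[R]_n -> \bar R) : Prop :=
  econvex (fun x => (f x + (rho / 2 * enorm x ^+ 2)%:E)%E).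

End optimization.

Section cutting_spheres.
Context {R : realType} {n m : nat}.
Implicit Types x y z b xt : 'rV[R]_n.

Definition quad (a : R) b : 'rV[R]_n -> R :=
  fun x => - a * enorm x ^+ 2 + dot b x.

Definition lsc_subdiff (rho : R) (f : 'rV[R]_n -> \bar R) xt :
    set ('rV[R]_n -> R) :=
  [set phi | [/\ (f xt < +oo)%E,
                 exists a b, rho / 2 <= a /\ phi = quad a b
               & forall x, ((phi x - phi xt)%:E <= f x - f xt)%E]].

Definition minorant (f : 'rV[R]_n -> \bar R) (phi : 'rV[R]_n -> R) xt x :
    \bar R :=
  ((phi x)%:E + f xt - (phi xt)%:E)%E.

Variables (f : 'I_m -> 'rV[R]_n -> \bar R) (rho a : 'I_m -> R) (z : 'rV[R]_n).

Definition objective x : R := 2^-1 * enorm (x - z) ^+ 2.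

Definition feasible : set 'rV[R]_n := [set x | forall i, (f i x <= 0)%E].

Definition active x : set 'I_m := [set i | (0 < f i x)%E].

(* The regions are indexed with a shift: O k.+1 stands for O_k, and O 0 for
   O_{-1}. The value of phi k i is unconstrained when i is not active at x k. *)
Definition cutting_spheres_run (x : nat -> 'rV[R]_n)
    (O : nat -> set 'rV[R]_n) (phi : nat -> 'I_m -> 'rV[R]_n -> R) : Prop :=
  [/\ x 0%N = z,
      O 0%N = setT,
      forall k, (active (x k) !=set0) ->
        [/\ forall i, active (x k) i ->
              lsc_subdiff (rho i) (f i) (x k) (phi k i) /\
              exists b, phi k i = quad (a i) b,
            O k.+1 = [set y | forall i, active (x k) i ->
                        (minorant (f i) (phi k i) (x k) y <= 0)%E] `&` O k
          & argmin (O k.+1) (fun y => enorm (y - z) ^+ 2) (x k.+1)]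
    & forall k, ~ (active (x k) !=set0) ->
        O k.+1 = O k /\ x k.+1 = x k].

Definition cutting_spheres (x : nat -> 'rV[R]_n) : Prop :=
  exists O phi, cutting_spheres_run x O phi.

End cutting_spheres.

Definition seq_cluster_point {T : topologicalType} (x : nat -> T) (p : T) :
    Prop :=
  exists2 s : nat -> nat, increasing_seq s & (x \o s) @ \oo --> p.

(* Main.v *)
(* The feasible set stays inside every region, so the iterates, being projections
   of z onto decreasing regions, have nondecreasing objective values bounded by
   the optimal value; hence they stay in a compact sublevel set. It remains to
   see that a cluster point p is feasible. If x_j, x_l are two iterates close to
   p with l > j and f_i(x_j) > 0, the cut made at x_j forces
   phi(x_l) - phi(x_j) <= - f_i(x_j), while the subgradient inequality at the
   reflected point y = 2 x_j - x_l gives phi(y) - phi(x_j) <= f_i(y) - f_i(x_j).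
   Since phi(x_l) + phi(y) - 2 phi(x_j) = - 2 a_i |x_l - x_j|^2, this yields
   f_i(x_j) <= f_i(y) - f_i(x_j) + 2 a_i |x_l - x_j|^2, which tends to 0 by
   continuity of f_i at p. *)
Require Import Defs.
From mathcomp Require Import all_boot all_order all_algebra.
From mathcomp Require Import all_classical all_reals all_analysis.
From mathcomp Require Import ring lra.

Set Implicit Arguments.
Unset Strict Implicit.
Unset Printing Implicit Defensive.

Import Order.TTheory GRing.Theory Num.Theory.
Import numFieldNormedType.Exports.

Local Open Scope classical_set_scope.
Local Open Scope ring_scope.

(** * Euclidean norm, quadratics and the objective *)

Lemma enorm_sqr (R : realType) (n : nat) (v : 'rV[R]_n) :
  enorm v ^+ 2 = dot v v.
Proof.
by rewrite /enorm sqr_sqrtr// sumr_ge0// => i _; rewrite -expr2 sqr_ge0.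
Qed.

(** A second difference kills the linear part, so only the curvature [a] survives. *)
Lemma quad_second_difference (R : realType) (n : nat) (a : R)
    (b x v : 'rV[R]_n) :
  quad a b (x + v) + quad a b (x - v) =
    2 * quad a b x - 2 * a * enorm v ^+ 2.
Proof.
rewrite /quad !enorm_sqr /dot !mulr_sumr -!big_split/= mulr_sumr -sumrB.
by apply: eq_bigr => i _; rewrite !mxE; ring.
Qed.

Lemma continuous_enorm_sqr (R : realType) (n : nat) (z : 'rV[R]_n) :
  continuous (fun x : 'rV[R]_n => enorm (x - z) ^+ 2).
Proof.
move=> x.
have -> : (fun x : 'rV[R]_n => enorm (x - z) ^+ 2) =
    (fun x : 'rV[R]_n => \sum_(i < n) (x 0 i - z 0 i) ^+ 2).
  apply/funext => y; rewrite enorm_sqr; apply: eq_bigr => i _.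
  by rewrite !mxE expr2.
apply: (@cvg_big _ _ _ _ _ _ _ (nbhs x) _
  (fun i (y : 'rV[R]_n) => (y 0 i - z 0 i) ^+ 2)
  (fun i => (x 0 i - z 0 i) ^+ 2)) => [|/= i _]; first exact: add_continuous.
apply: (@cvg_comp _ _ _ (fun y : 'rV[R]_n => y 0 i - z 0 i)
  (fun r => r ^+ 2) (nbhs x) (nbhs (x 0 i - z 0 i))); last first.
  exact: exprn_continuous.
by apply: (@cvgB _ _ _ (nbhs x) _ (fun y : 'rV[R]_n => y 0 i) (cst (z 0 i)));
  [exact: coord_continuous|exact: cvg_cst].
Qed.

Lemma objective_ge0 (R : realType) (n : nat) (z y : 'rV[R]_n) :
  0 <= objective z y.
Proof. by rewrite mulr_ge0// sqr_ge0. Qed.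

Lemma continuous_objective (R : realType) (n : nat) (z : 'rV[R]_n) :
  continuous (objective z).
Proof.
move=> y; apply: (cvg_comp _ _ (@continuous_enorm_sqr R n z y)).
exact: mulrl_continuous.
Qed.

Lemma compact_objective_sublevel (R : realType) (n : nat) (z : 'rV[R]_n)
    (c : R) :
  compact [set y | objective z y <= c].
Proof.
apply: bounded_closed_compact; last first.
  have /continuous_closedP/(_ [set r | r <= c]) := @continuous_objective R n z.
  by apply; exact: closed_le.
(* The norm here is the max norm: a coordinate [t] of [y - z] has [t ^+ 2 <= 2 * c], and
   [|t| <= 1 + t ^+ 2] avoids a square root. *)
exists (`|z| + (1 + 2 * c)); split; first exact: num_real.
move=> M zM y /= yc.
have c0 : 0 <= c by exact: le_trans (objective_ge0 z y) yc.
rewrite (le_trans _ (ltW zM))// -lerBlDl (le_trans (lerB_dist _ _))//.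
rewrite [leLHS]mx_normrE; apply: bigmax_le => [|[i j] _ /=].
  by rewrite addr_ge0// mulr_ge0.
have : (y - z) i j ^+ 2 <= 2 * c.
  rewrite ord1; apply: (@le_trans _ _ (enorm (y - z) ^+ 2)); last first.
    by move: yc; rewrite /objective; lra.
  rewrite enorm_sqr /dot (bigD1 j)//= -expr2 lerDl sumr_ge0// => k _.
  by rewrite -expr2 sqr_ge0.
set t := (y - z) i j => tc.
rewrite ler_norml; apply/andP; split; nra.
Qed.

(** * Cluster points, subsequences and minimizers *)

(** The balls of radius [k.+1%:R^-1] form a countable base at [p], so a subsequence can be extracted
    term by term. *)
Lemma cluster_seq_cluster_point (R : realType) (T : pseudoMetricType R)
    (x : nat -> T) (p : T) :
  cluster (x @ \oo) p -> seq_cluster_point x p.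
Proof.
move=> xp.
have near_p (kN : nat * nat) :
    exists n, (kN.2 <= n)%N /\ ball p (kN.1.+1%:R^-1) (x n).
  have xN : (x @ \oo) (x @` [set n | (kN.2 <= n)%N]).
    by exists kN.2 => // n /= Nn; exists n.
  have pb : nbhs p (ball p (kN.1.+1%:R^-1 : R)).
    by apply: nbhsx_ballx; rewrite invr_gt0 ltr0n.
  by have [_ [[n ? <-] ?]] := xp _ _ xN pb; exists n.
have {near_p} [g gP] := choice near_p.
(* The first argument of [g] sets the radius; the second is a lower bound on the index, which makes
   [s] strictly increasing. *)
pose s := fix s k := if k is k'.+1 then g (k, (s k').+1) else g (0%N, 0%N).
exists s.
  apply/increasing_seqP => k.
  by have [] := gP (k.+1, (s k).+1).
apply/cvg_ballP => e e0.
have near_inv := near_infty_natSinv_lt (PosNum e0).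
have s_ball k : ball p (k.+1%:R^-1 : R) (x (s k)).
  by case: k => [|k]; [exact: (gP (0%N, 0%N)).2|exact: (gP (k.+1, _)).2].
near=> k; apply: le_ball (s_ball k).
by apply: ltW; near: k.
Unshelve. all: by end_near. Qed.

Lemma increasing_seq_cvgny (s : nat -> nat) :
  increasing_seq s -> s @ \oo --> \oo.
Proof.
move=> /increasing_seqP sS.
have le_s k : (k <= s k)%N by elim: k => // k IH; exact: leq_ltn_trans (sS k).
by move=> A [N _ NA]; exists N => // k /leq_trans /(_ (le_s k)) /NA.
Qed.

Lemma argmin_inf (R : realType) (T : Type) (D : set T) (J : T -> R) (p : T) :
  has_lbound (J @` D) -> D p -> J p <= inf (J @` D) -> argmin D J p.
Proof.
move=> lb Dp Jp; split=> // y Dy; apply: (le_trans Jp).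
by apply: ge_inf => //; exists y.
Qed.

(* Reflecting [x] through [xt] eliminates the slope [b] of the cut, so no bound
   on the chosen slopes is ever needed. *)
Lemma cut_reflection_bound (R : realType) (n : nat) (f : 'rV[R]_n -> \bar R)
    (a : R) (b xt x : 'rV[R]_n) :
  f xt \is a fin_num -> f (xt - (x - xt)) \is a fin_num ->
  (forall y, ((quad a b y - quad a b xt)%:E <= f y - f xt)%E) ->
  (minorant f (quad a b) xt x <= 0)%E ->
  fine (f xt) <=
    fine (f (xt - (x - xt))) - fine (f xt) + 2 * a * enorm (x - xt) ^+ 2.
Proof.
move=> + + /(_ (xt - (x - xt))).
have := quad_second_difference a b xt (x - xt); rewrite /minorant subrKC.
case: (f xt) => [r||]//; case: (f (xt - (x - xt))) => [s||]// quadE _ _ /=.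
by rewrite -EFinD -!EFinB !lee_fin; lra.
Qed.

(** * Invariants of a run and feasibility of its cluster points *)

Section run.
Context {R : realType} {n m : nat} (f : 'I_m -> 'rV[R]_n -> \bar R)
  (rho a : 'I_m -> R) (z : 'rV[R]_n) (x : nat -> 'rV[R]_n)
  (O : nat -> set 'rV[R]_n) (phi : nat -> 'I_m -> 'rV[R]_n -> R).
Hypothesis f_proper : forall i, proper_function (f i).
Hypothesis run : cutting_spheres_run f rho a z x O phi.

Lemma run_region_antitone k l : (k <= l)%N -> O l `<=` O k.
Proof.
move=> /subnK <-; elim: (l - k)%N => [//|j IH]; rewrite addSn.
apply: subset_trans IH; case: run => _ _ act inact.
have [/act [_ -> _]|/inact [-> _]//] := pselect (active f (x (j + k)) !=set0).
by move=> y [].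
Qed.

(** With shifted indices, [O k] is the region from which [x k] was chosen. At the start [z]
    minimizes over the whole space; an idle step changes neither point nor region. *)
Lemma run_argmin k : argmin (O k) (objective z) (x k).
Proof.
case: run => x0 O0 act inact; elim: k => [|k IH].
  rewrite x0 O0; split=> // y _; apply: le_trans (objective_ge0 z y).
  by rewrite /objective subrr enorm_sqr /dot big1 ?mulr0// => i _; rewrite mxE mul0r.
have [/act [_ _ [Ox xmin]]|/inact [-> -> //]] := pselect (active f (x k) !=set0).
by split=> // y /xmin; rewrite /objective ler_pM2l.
Qed.

(** The existence of a subgradient at [x k] rules out [+oo], and properness rules out [-oo]. *)
Lemma active_fin_num k i : active f (x k) i -> f i (x k) \is a fin_num.
Proof.
case: run => _ _ act _ ik.
have [/(_ i ik)[[fx _ _] _] _ _] := act k (ex_intro _ i ik).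
by rewrite fin_numE (f_proper i).1 lt_eqF.
Qed.

(** Regions only shrink, so a cut binds every later iterate. *)
Lemma run_cut k l i : active f (x k) i -> (k < l)%N ->
  (minorant (f i) (phi k i) (x k) (x l) <= 0)%E.
Proof.
case: run => _ _ act _ ik kl.
have [_ Ok _] := act k (ex_intro _ i ik).
have /(run_region_antitone kl) : O l (x l) by case: (run_argmin l).
by rewrite Ok => -[/(_ i ik)].
Qed.

(** Each minorant lies below [f i], hence is nonpositive at feasible points: no cut removes them. *)
Lemma feasible_region k : feasible f `<=` O k.
Proof.
case: run => x0 O0 act inact; elim: k => [|k IH] y Ay; first by rewrite O0.
have [ak|/inact [-> _]] := pselect (active f (x k) !=set0); last exact: IH.
have [sub -> _] := act k ak; split; last exact: IH.
move=> i ik; have [[_ _ /(_ y) sub_y] _] := sub i ik.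
move: (Ay i) sub_y (active_fin_num ik); rewrite /minorant.
case: (f i y) => [r||]//; case: (f i (x k)) => [s||]//.
by rewrite -EFinD -!EFinB !lee_fin; lra.
Qed.

Lemma run_objective_le_inf k : feasible f !=set0 ->
  objective z (x k) <= inf (objective z @` feasible f).
Proof.
move=> [y Ay]; apply: lb_le_inf; first by exists (objective z y), y.
by move=> _ [w Aw <-]; apply: (run_argmin k).2; exact: feasible_region.
Qed.

Lemma run_objective_nondecreasing : nondecreasing_seq (objective z \o x).
Proof.
move=> k l kl /=; apply: (run_argmin k).2; apply: run_region_antitone kl _ _.
by case: (run_argmin l).
Qed.

(** If [f i p] were positive, continuity would make [i] active along the tail of the subsequence.
    The reflection bound for consecutive terms then passes to the limit and gives [f i p <= 0]. *)
Lemma cluster_point_le0 i p (U : set 'rV[R]_n) : open U -> U p ->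
  (forall y, U y -> f i y \is a fin_num) -> {within U, continuous (f i)} ->
  seq_cluster_point x p -> (f i p <= 0)%E.
Proof.
move=> oU Up ffin; rewrite continuous_open_subspace// => fc [s sincr xsp].
rewrite leNgt; apply/negP => fp0.
have fpfin := ffin _ Up.
have fcp : f i @ p --> (fine (f i p))%:E by rewrite fineK//; apply: fc; exact/mem_set.
have xs1p : (fun j => x (s j.+1)) @ \oo --> p by rewrite (cvg_shiftS (x \o s)).
have dp : (fun j => x (s j.+1) - x (s j)) @ \oo --> p - p by exact: cvgB.
(* Reflection of [x (s j.+1)] through [x (s j)]; it also tends to [p], hence is eventually in the
   open set [U], where [f i] is finite. *)
pose y j := x (s j) - (x (s j.+1) - x (s j)).
have yp : y @ \oo --> p.
  by rewrite -[X in _ --> X]subr0 -[in X in _ --> X](subrr p); exact: cvgB.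
have gx : (fun j => fine (f i (x (s j)))) @ \oo --> fine (f i p).
  by apply: fine_cvg; exact: cvg_comp xsp fcp.
have gy : (fun j => fine (f i (y j))) @ \oo --> fine (f i p).
  by apply: fine_cvg; exact: cvg_comp yp fcp.
have lim : (fun j => fine (f i (y j)) - fine (f i (x (s j))) +
    2 * a i * enorm (x (s j.+1) - x (s j)) ^+ 2) @ \oo --> 0.
  (* The limit 0 is written in the shape of the sequence; the trailing [- 0] matches
     [continuous_enorm_sqr] with centre 0. *)
  have -> : 0 = fine (f i p) - fine (f i p) + 2 * a i * enorm (p - p - 0) ^+ 2.
    by rewrite !subrr enorm_sqr /dot big1 ?mulr0 ?addr0// => j _; rewrite mxE mul0r.
  apply: cvgD; first exact: cvgB.
  apply: cvgM; first exact: cvg_cst.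
  under eq_fun do rewrite -[in enorm _](subr0 (x _ - x _)).
  exact: (cvg_comp _ _ dp (@continuous_enorm_sqr _ _ 0 _)).
have : fine (f i p) <= 0.
  apply: (ler_cvg_to gx lim).
  have Uy : \forall j \near \oo, U (y j) by apply: yp; exact: open_nbhs_nbhs.
  have fx0 : \forall j \near \oo, 0 < fine (f i (x (s j))).
    by apply: (cvgr_gt _ gx); rewrite fine_gt0// fp0 ltey_eq fpfin.
  near=> j.
  have ij : active f (x (s j)) i.
    have : 0 < fine (f i (x (s j))) by near: j.
    (* Since [fine] sends both infinities to 0, a positive [fine] forces a positive real value. *)
    rewrite /active/=; case: (f i (x (s j))) => [r||]//=; rewrite ?ltxx//.
  case: run => _ _ act _.
  have [/(_ i ij)[[_ _ phi_sub] [b phib]] _ _] := act _ (ex_intro _ i ij).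
  have := run_cut ij (_ : (s j < s j.+1)%N); rewrite phib in phi_sub *.
  move=> cut; apply: cut_reflection_bound phi_sub (cut _).
  - exact: active_fin_num.
  - by apply: ffin; near: j.
  - by move/increasing_seqP : sincr; apply.
by rewrite leNgt fine_gt0// fp0 ltey_eq fpfin.
Unshelve. all: by end_near. Qed.

End run.

Theorem theorem5p3 (R : realType) (n m : nat) (z : 'rV[R]_n)
    (f : 'I_m -> 'rV[R]_n -> \bar R) (rho a : 'I_m -> R)
    (x : nat -> 'rV[R]_n)
    (rho_ge0 : forall i, 0 <= rho i)
    (f_proper : forall i, proper_function (f i))
    (f_lsc : forall i, lower_semicontinuous (f i))
    (f_wcvx : forall i, weakly_convex (rho i) (f i))
    (a_ge : forall i, rho i / 2 <= a i)
    (feasible_neq0 : feasible f !=set0)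
    (f_cont : exists alpha : R, inf (objective z @` feasible f) < alpha /\
       exists U : set 'rV[R]_n,
         [/\ open U,
             [set y | objective z y <= alpha] `<=` U
           & forall i, (forall y, U y -> f i y \is a fin_num) /\
                       {within U, continuous (f i)}])
    (x_gen : cutting_spheres f rho a z x) :
  [/\ (exists p, seq_cluster_point x p) /\
      (forall p, seq_cluster_point x p ->
         argmin (feasible f) (objective z) p),
      forall p, argmin (feasible f) (objective z) = [set p] -> x @ \oo --> p
    & nondecreasing_seq (objective z \o x) /\
      (objective z \o x) @ \oo --> inf (objective z @` feasible f)].
Proof.
have [region [phi run]] := x_gen.
have [alpha [Jalpha [U [oU sublevelU fU]]]] := f_cont.
set Jstar := inf _ in Jalpha *.
have J_le k : objective z (x k) <= Jstar := run_objective_le_inf f_proper run k feasible_neq0.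
have cluster_le p : seq_cluster_point x p -> objective z p <= Jstar.
  move=> [s _ xsp].
  have Jxs := cvg_comp _ _ xsp (@continuous_objective R n z p).
  by apply: (ler_cvg_to Jxs (cvg_cst Jstar)); near=> k; exact: J_le.
have lbJ : has_lbound (objective z @` feasible f).
  by exists 0 => _ [y _ <-]; exact: objective_ge0.
have cluster_argmin p : seq_cluster_point x p ->
    argmin (feasible f) (objective z) p.
  move=> xp; apply: argmin_inf => //; last exact: cluster_le.
  move=> i; have [ffin fc] := fU i.
  apply: (cluster_point_le0 f_proper run oU _ ffin fc xp).
  by apply: sublevelU => /=; exact: le_trans (cluster_le _ xp) (ltW Jalpha).
have [|p [_ clp]] := @compact_objective_sublevel R n z Jstar (x @ \oo) _.
  by exists 0%N => // k _; exact: J_le.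
have xp : seq_cluster_point x p by exact: cluster_seq_cluster_point.
split; first by split; [exists p|].
- move=> q argq.
  have cluster_q r : cluster (x @ \oo) r -> r = q.
    by move/cluster_seq_cluster_point/cluster_argmin; rewrite argq.
  (* The level is [alpha] rather than [Jstar] because the compact set must be a neighbourhood of
     [q]. *)
  apply: (@compact_cluster_set1 _ _ _ [set y | objective z y <= alpha]).
  + exact: norm_hausdorff.
  + exact: compact_objective_sublevel.
  + have : objective z q < alpha.
      by rewrite -(cluster_q _ clp); exact: le_lt_trans (cluster_le _ xp) Jalpha.
    move=> /(cvgr_lt _ (@continuous_objective R n z q)); apply: filterS => y.
    exact: ltW.
  + by exists 0%N => // k _; exact: le_trans (J_le k) (ltW Jalpha).
  + apply/seteqP; split=> [r /cluster_q|_ ->]//.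
    by rewrite -(cluster_q _ clp).
have Jmon := run_objective_nondecreasing run.
split=> //.
(* Monotone convergence yields a limit; the subsequence tending to [p] identifies it as
   [objective z p], which equals [Jstar] because [p] is feasible. *)
have Jcvg : objective z \o x @ \oo --> sup (range (objective z \o x)).
  by apply: nondecreasing_cvgn => //; exists Jstar => _ [k _ <-]; exact: J_le.
have [s sincr xsp] := xp.
have Jsp : (objective z \o x) \o s @ \oo --> objective z p.
  exact: cvg_comp xsp (@continuous_objective R n z p).
have Jp : objective z p = Jstar.
  apply/eqP; rewrite eq_le cluster_le//=; apply: ge_inf => //.
  by exists p => //; exact: (cluster_argmin p xp).1.
have Jssup : (objective z \o x) \o s @ \oo --> sup (range (objective z \o x)).
  apply: cvg_comp Jcvg; exact: increasing_seq_cvgny.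
have <- // : sup (range (objective z \o x)) = Jstar.
by rewrite -Jp; exact: cvg_unique Jssup Jsp.
Unshelve. all: by end_near. Qed.
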